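(* Let $(TM,\lambda)$ be an EAP-space. The curvature tensor $\mathbf R=(R^\alpha_{\beta\mu\nu},R^a_{b\mu\nu},P^\alpha_{\beta\nu c},P^a_{b\nu c},S^\alpha_{\beta bc},S^a_{bcd})$ of the canonical $d$-connection of $(TM,\lambda)$ vanishes identically.
   Context: Let $M$ be a smooth paracompact $n$-manifold, $TM$ its tangent bundle with induced local coordinates $(x^\mu,y^a)$, and $N=(N^a_\mu(x,y))$ a given nonlinear connection on $TM$. Greek indices denote horizontal and Latin indices vertical components; both run over $1,\dots,n$; repeated indices (including the mesh index $i$) are summed. Put $\dot\partial_a=\partial/\partial y^a$, $\delta_\mu=\partial/\partial x^\mu-N^a_\mu\dot\partial_a$; $(\delta_\mu,\dot\partial_a)$ is the adapted frame. A $d$-connection is a linear connection $D$ on $TM$ preserving by parallelism the horizontal and the vertical distribution; its coefficients $(\Gamma^\alpha_{\mu\nu},\Gamma^a_{b\nu},C^\alpha_{\mu c},C^a_{bc})$ are defined by $D_{\delta_\nu}\delta_\mu=\Gamma^\alpha_{\mu\nu}\delta_\alpha$, $D_{\delta_\nu}\dot\partial_b=\Gamma^a_{b\nu}\dot\partial_a$, $D_{\dot\partial_c}\delta_\mu=C^\alpha_{\mu c}\delta_\alpha$, $D_{\dot\partial_c}\dot\partial_b=C^a_{bc}\dot\partial_a$. Its curvature $\mathbf R(X,Y)Z=D_XD_YZ-D_YD_XZ-D_{[X,Y]}Z$ has components $\mathbf R(\delta_\mu,\delta_\nu)\delta_\beta=R^\alpha_{\beta\mu\nu}\delta_\alpha$,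 $\mathbf R(\delta_\mu,\delta_\nu)\dot\partial_b=R^a_{b\mu\nu}\dot\partial_a$, $\mathbf R(\dot\partial_c,\delta_\nu)\delta_\beta=P^\alpha_{\beta\nu c}\delta_\alpha$, $\mathbf R(\dot\partial_c,\delta_\nu)\dot\partial_b=P^a_{b\nu c}\dot\partial_a$, $\mathbf R(\dot\partial_b,\dot\partial_c)\delta_\beta=S^\alpha_{\beta bc}\delta_\alpha$, $\mathbf R(\dot\partial_c,\dot\partial_d)\dot\partial_b=S^a_{bcd}\dot\partial_a$. EAP-space $(TM,\lambda)$: $TM$ with the nonlinear connection $N$ and $n$ vector fields $\lambda_i=\lambda_i^\alpha\delta_\alpha+\lambda_i^a\dot\partial_a$ ($i=1,\dots,n$) defined globally on $TM$ such that the horizontal parts $\lambda_i^\alpha\delta_\alpha$ are linearly independent and the vertical parts $\lambda_i^a\dot\partial_a$ are linearly independent. $(\lambda_{i\alpha})$, $(\lambda_{ia})$ denote the inverse matrices of $(\lambda_i^\alpha)$, $(\lambda_i^a)$. The canonical $d$-connection is the unique $d$-connection for which all $\lambda_i^\alpha\delta_\alpha$ and all $\lambda_i^a\dot\partial_a$ are parallel ($\lambda_i^\alpha{}_{|\mu}=\lambda_i^\alpha{}_{||c}=\lambda_i^a{}_{|\mu}=\lambda_i^a{}_{||c}=0$, with $|$, $||$ its covariant derivatives along $\delta_\mu$, $\dot\partial_c$); explicitly $\Gamma^\alpha_{\mu\nu}=\lambda_i^\alpha\delta_\nu\lambda_{i\mu}$, $\Gamma^a_{b\nu}=\lambda_i^a\delta_\nu\lambda_{ib}$,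 $C^\alpha_{\mu c}=\lambda_i^\alpha\dot\partial_c\lambda_{i\mu}$, $C^a_{bc}=\lambda_i^a\dot\partial_c\lambda_{ib}$. *)

(* Defs.v *)
From HB Require Import structures.
From mathcomp Require Import all_boot all_order all_algebra.
From mathcomp Require Import all_classical all_reals.
From mathcomp Require Import topology normedtype landau derive.

Set Implicit Arguments.
Unset Strict Implicit.
Unset Printing Implicit Defensive.

Import Order.TTheory GRing.Theory Num.Theory.
Import numFieldNormedType.Exports.

Local Open Scope classical_set_scope.
Local Open Scope ring_scope.

(* Meant for an open set [A] of a finite-dimensional space [V]: [Ck k A f] then
   says that [f] is of class C^k on [A]. *)
Fixpoint Ck (R : realType) (V W : normedModType R) (k : nat) (A : set V)
    (f : V -> W) : Prop :=
  if k is k'.+1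
  then (forall x, A x -> differentiable f x) /\ forall v, Ck k' A ('D_v f)
  else forall x, A x -> {for x, continuous f}.

Definition smooth (R : realType) (V W : normedModType R) (A : set V)
  (f : V -> W) : Prop := forall k, Ck k A f.

Section SmoothTheory.
Variable R : realType.
Implicit Types V W U : normedModType R.

Lemma open_near V (A : set V) x : open A -> A x -> \forall y \near x, A y.
Proof. by move=> oA Ax; exact: open_nbhs_nbhs. Qed.

Lemma near_eq_differentiable V W (f g : V -> W) x :
  (\forall y \near x, f y = g y) -> differentiable f x -> differentiable g x.
Proof.
move=> fg df.
have fgx : f x = g x by exact: nbhs_singleton fg.
have gE : g \o shift x = cst (g x) + 'd f x +o_ 0 id.
  apply/eqaddoP => e e0; have /eqaddoP/(_ e e0) := diff_locally df.
  have shx : (fun h : V => h + x) @ 0 --> x.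
    have : (fun h : V => h + x) @ 0 --> 0 + x.
      by apply: cvgD; [exact: cvg_id|exact: cvg_cst].
    by rewrite add0r.
  have shg : \forall h \near (0 : V), f (h + x) = g (h + x) by exact: shx fg.
  apply: filter_app; apply: filterS shg => h /= fgh.
  by rewrite !fctE /= -fgh fgx.
apply/diff_locallyP.
have gd : 'd g x = 'd f x :> (V -> W).
  by apply: diff_unique gE; exact: diff_continuous.
by rewrite gd; split=> //; exact: diff_continuous.
Qed.

Lemma Ck_ext V W k (A : set V) (f g : V -> W) : open A ->
  (forall x, A x -> f x = g x) -> Ck k A f -> Ck k A g.
Proof.
move=> oA; elim: k f g => [|k IH] f g fg.
  move=> cf x Ax; suff: g @ x --> g x by [].
  rewrite -(fg _ Ax); apply: cvg_trans (cf x Ax); apply: near_eq_cvg.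
  by apply: filterS (open_near oA Ax) => y /fg.
have nfg x : A x -> \forall y \near x, f y = g y.
  by move=> Ax; apply: filterS (open_near oA Ax) => y /fg.
move=> [df Df]; split=> [x Ax|v].
  exact: near_eq_differentiable (nfg x Ax) (df x Ax).
by apply: IH (Df v) => x Ax; exact: near_eq_derive (nfg x Ax).
Qed.

Lemma Ck_cst V W k (A : set V) (c : W) : Ck k A (cst c).
Proof.
elim: k c => [|k IH] c; first by move=> x _; exact: cvg_cst.
split=> [x _|v]; first exact: differentiable_cst.
have -> : 'D_v (cst c) = cst (0 : W) by apply/funext => x; rewrite derive_cst.
exact: IH.
Qed.

Lemma derive_lin V W (L : {linear V -> W}) x v :
  continuous L -> 'D_v L x = L v.
Proof.
move=> cL; rewrite deriveE; last exact: linear_differentiable.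
by rewrite (diff_lin x cL).
Qed.

Lemma derive_comp V W U (f : V -> W) (g : W -> U) x v :
  differentiable f x -> differentiable g (f x) ->
  'D_v (g \o f) x = 'D_('D_v f x) g (f x).
Proof.
move=> df dg; rewrite (deriveE _ df) (deriveE _ dg).
rewrite deriveE; last exact: differentiable_comp.
by rewrite (diff_comp df dg).
Qed.

Lemma Ck_lin V W k (A : set V) (L : {linear V -> W}) :
  continuous L -> Ck k A L.
Proof.
move=> cL; case: k => [|k]; first by move=> x _; exact: cL.
have dL x : differentiable L x by exact: linear_differentiable.
split=> // v.
have -> : 'D_v L = cst (L v) by apply/funext => x; exact: derive_lin.
exact: Ck_cst.
Qed.

Lemma Ck_add V W k (A : set V) (f g : V -> W) : open A ->
  Ck k A f -> Ck k A g -> Ck k A (f + g).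
Proof.
move=> oA; elim: k f g => [|k IH] f g.
  by move=> cf cg x Ax; apply: cvgD; [exact: cf|exact: cg].
move=> [df Df] [dg Dg]; split=> [x Ax|v].
  by apply: differentiableD; [exact: df|exact: dg].
apply: Ck_ext (IH _ _ (Df v) (Dg v)) => // x Ax.
by rewrite deriveD //; apply: diff_derivable; [exact: df|exact: dg].
Qed.

Lemma Ck_postcomp V W U k (A : set V) (f : V -> W) (L : {linear W -> U}) :
  open A -> continuous L -> Ck k A f -> Ck k A (L \o f).
Proof.
move=> oA cL; elim: k f => [|k IH] f.
  by move=> cf x Ax; apply: continuous_comp; [exact: cf|exact: cL].
have dL x : differentiable L x by exact: linear_differentiable.
move=> [df Df]; split=> [x Ax|v].
  by apply: differentiable_comp => //; exact: df.
apply: Ck_ext (IH _ (Df v)) => // x Ax /=.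
by rewrite derive_comp ?derive_lin //; exact: df.
Qed.

Lemma Ck_precomp V W U k (A : set V) (f : V -> W) (L : {linear U -> V}) :
  open A -> continuous L -> Ck k A f -> Ck k (L @^-1` A) (f \o L).
Proof.
move=> oA cL; elim: k f => [|k IH] f.
  by move=> cf x Ax; apply: continuous_comp; [exact: cL|exact: cf].
have oLA : open (L @^-1` A) by apply: open_comp => // x _; exact: cL.
have dL x : differentiable L x by exact: linear_differentiable.
move=> [df Df]; split=> [x Ax|v].
  by apply: differentiable_comp => //; exact: df.
apply: Ck_ext (IH _ (Df (L v))) => // x Ax /=.
by rewrite derive_comp ?derive_lin //; exact: df.
Qed.

Lemma Ck_S V W k (A : set V) (f : V -> W) : Ck k.+1 A f -> Ck k A f.
Proof.
elim: k f => [|k IH] f [df Df].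
  by move=> x Ax; exact/differentiable_continuous/df.
by split=> // v; exact/IH/Df.
Qed.

Let scale_bilinear W : bilinear_for
    (GRing.Scale.Law.clone _ _ *:%R _) (GRing.Scale.Law.clone _ _ *:%R _)
    (fun (a : R) (w : W) => a *: w).
Proof.
split=> [w|a] b x y /=; first by rewrite scalerDl scalerA.
by rewrite scalerDr !scalerA mulrC.
Qed.

Lemma differentiable_scale V W (h : V -> R) (f : V -> W) x :
  differentiable h x -> differentiable f x ->
  differentiable (fun y => h y *: f y) x /\
  forall v, 'd (fun y => h y *: f y) x v = h x *: 'd f x v + 'd h x v *: f x.
Proof.
move=> dh df.
pose sM := bilinear_isBilinear.Build R R W W _ _ _ (scale_bilinear W).
pose s : {bilinear R -> W -> W} := HB.pack (fun (a : R) (w : W) => a *: w) sM.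
have cs : continuous (fun p : R * W => s p.1 p.2).
  by move=> p; apply: cvgZ; [exact: cvg_fst|exact: cvg_snd].
have dp := differentiable_pair dh df.
have db : differentiable (fun p : R * W => s p.1 p.2) (h x, f x).
  exact: differentiable_bilin.
split; first exact: differentiable_comp dp db.
move=> v.
have -> : (fun y => h y *: f y) =
    (fun p : R * W => s p.1 p.2) \o (fun y => (h y, f y)) by [].
have e := diff_bilin (h x, f x) cs.
by rewrite (diff_comp dp db) [LHS]/= (diff_pair dh df) e.
Qed.

Lemma Ck_scale V W k (A : set V) (h : V -> R) (f : V -> W) : open A ->
  Ck k A h -> Ck k A f -> Ck k A (fun x => h x *: f x).
Proof.
move=> oA; elim: k h f => [|k IH] h f.
  by move=> ch cf x Ax; apply: cvgZ; [exact: ch|exact: cf].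
move=> ckh ckf; have [dh Dh] := ckh; have [df Df] := ckf.
split=> [x Ax|v]; first by case: (differentiable_scale (dh x Ax) (df x Ax)).
have := Ck_add oA (IH _ _ (Ck_S ckh) (Df v)) (IH _ _ (Dh v) (Ck_S ckf)).
apply: Ck_ext => // x Ax.
have [ds es] := differentiable_scale (dh x Ax) (df x Ax).
rewrite !fctE (deriveE _ ds) es deriveE ?deriveE //; [exact: dh|exact: df].
Qed.

Lemma Ck_sum V W k (A : set V) n (f : 'I_n -> V -> W) : open A ->
  (forall i, Ck k A (f i)) -> Ck k A (\sum_i f i).
Proof.
move=> oA cf; elim/big_ind: _ => //; first exact: Ck_cst.
by move=> g h; exact: Ck_add.
Qed.

Lemma continuous_row_mxl m n :
  continuous (fun x : 'rV[R]_m => row_mx x (0 : 'rV[R]_n)).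
Proof.
move=> u A /nbhs_ballP[e /= e0 eA].
apply/nbhs_ballP; exists e => //= v [_ uv]; apply: eA; split => // i j.
rewrite !mxE; case: (fintype.split j) => k; first exact: uv.
by rewrite !mxE; exact: ballxx.
Qed.

Lemma continuous_row_mxr m n :
  continuous (fun y : 'rV[R]_n => row_mx (0 : 'rV[R]_m) y).
Proof.
move=> u A /nbhs_ballP[e /= e0 eA].
apply/nbhs_ballP; exists e => //= v [_ uv]; apply: eA; split => // i j.
rewrite !mxE; case: (fintype.split j) => k; last exact: uv.
by rewrite !mxE; exact: ballxx.
Qed.

Lemma smooth_row_mx V m n (A : set V) (f : V -> 'rV[R]_m) (g : V -> 'rV[R]_n) :
  open A -> smooth A f -> smooth A g -> smooth A (fun x => row_mx (f x) (g x)).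
Proof.
move=> oA cf cg k.
have lin_l : linear (fun x : 'rV[R]_m => row_mx x (0 : 'rV[R]_n)).
  by move=> a x y; rewrite scale_row_mx add_row_mx scaler0 addr0.
have lin_r : linear (fun y : 'rV[R]_n => row_mx (0 : 'rV[R]_m) y).
  by move=> a x y; rewrite scale_row_mx add_row_mx scaler0 addr0.
pose l : {linear _ -> _} := HB.pack (fun x : 'rV[R]_m => row_mx x (0 : 'rV[R]_n))
  (GRing.isLinear.Build _ _ _ _ _ lin_l).
pose r : {linear _ -> _} := HB.pack (fun y : 'rV[R]_n => row_mx (0 : 'rV[R]_m) y)
  (GRing.isLinear.Build _ _ _ _ _ lin_r).
have cl := @Ck_postcomp _ _ _ k _ f l oA (@continuous_row_mxl m n) (cf k).
have cr := @Ck_postcomp _ _ _ k _ g r oA (@continuous_row_mxr m n) (cg k).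
apply: Ck_ext (Ck_add oA cl cr) => // x _.
by rewrite !fctE /= add_row_mx addr0 add0r.
Qed.

Lemma smooth_tangent m n (A : set 'rV[R]_m) (f : 'rV[R]_m -> 'rV[R]_n) :
  open A -> smooth A f ->
  smooth [set w : 'rV[R]_(m + m) | A (lsubmx w)]
    (fun w => row_mx (f (lsubmx w)) ('D_(rsubmx w) f (lsubmx w))).
Proof.
move=> oA cf.
have cl : continuous (lsubmx : 'rV[R]_(m + m) -> 'rV[R]_m).
  exact: continuous_lsubmx.
pose l : {linear 'rV[R]_(m + m) -> 'rV[R]_m} := lsubmx.
have oB : open [set w : 'rV[R]_(m + m) | A (lsubmx w)].
  by apply: (@open_comp _ _ lsubmx) => // x _; exact: cl.
apply: smooth_row_mx => //.
  by move=> k; exact: (@Ck_precomp _ _ _ k A f l oA cl (cf k)).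
move=> k.
have cj (j : 'I_m) : Ck k [set w : 'rV[R]_(m + m) | A (lsubmx w)]
    (fun w => rsubmx w 0 j *: 'D_(delta_mx 0 j) f (lsubmx w)).
  apply: Ck_scale => //; last first.
    exact: (@Ck_precomp _ _ _ k A _ l oA cl ((cf k.+1).2 _)).
  have lin_j : linear_for *%R (fun w : 'rV[R]_(m + m) => rsubmx w 0 j : R).
    by move=> a x y; rewrite !mxE.
  pose p : {linear 'rV[R]_(m + m) -> R} :=
    HB.pack (fun w : 'rV[R]_(m + m) => rsubmx w 0 j : R)
      (GRing.isLinear.Build _ _ _ _ _ lin_j).
  apply: (@Ck_lin _ _ _ _ p) => w.
  apply: (@continuous_comp _ _ _ rsubmx (fun y : 'rV[R]_m => y 0 j)).
    exact: continuous_rsubmx.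
  exact: coord_continuous.
apply: Ck_ext (Ck_sum oB cj) => // w Aw.
have df := (cf 1%N).1 _ Aw.
rewrite fct_sumE (deriveE _ df) [X in 'd f _ X]row_sum_delta linear_sum.
by apply: eq_bigr => j _; rewrite linearZ /= -deriveE.
Qed.

End SmoothTheory.

(* A smooth atlas on a set: its topology is the one making all charts
   homeomorphisms onto open sets. [coord c] and [param c] matter only on
   [dom c] and on the image of [dom c]. *)
Record manifold (R : realType) (m : nat) := Manifold {
  carrier :> Type;
  chart : Type;
  dom : chart -> set carrier;
  coord : chart -> carrier -> 'rV[R]_m;
  param : chart -> 'rV[R]_m -> carrier;
  dom_cover : forall p, exists c, dom c p;
  coordK : forall c p, dom c p -> param c (coord c p) = p;
  open_overlap : forall c c', open (coord c @` (dom c `&` dom c'));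
  smooth_transition : forall c c',
    smooth (coord c @` (dom c `&` dom c')) (fun x => coord c' (param c x))
}.

Section ManifoldTopology.
Variables (R : realType) (m : nat).
Implicit Type M : manifold R m.

HB.instance Definition _ M := gen_eqMixin (carrier M).
HB.instance Definition _ M := gen_choiceMixin (carrier M).

Definition manifold_open M (W : set M) : Prop :=
  forall c : chart M, open (coord c @` (W `&` dom c)).

Lemma coord_inj M (c : chart M) (p q : M) :
  dom c p -> dom c q -> coord c p = coord c q -> p = q.
Proof. by move=> cp cq e; rewrite -(coordK cp) e coordK. Qed.

Fact manifold_openT M : @manifold_open M setT.
Proof.
by move=> c; rewrite setTI -[dom c]setIid; exact: open_overlap.
Qed.

Fact manifold_openI M : setI_closed (@manifold_open M).
Proof.
move=> A B oA oB c.
suff -> : coord c @` (A `&` B `&` dom c) =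
    coord c @` (A `&` dom c) `&` coord c @` (B `&` dom c) by exact: openI.
apply/seteqP; split=> [_ [p [[Ap Bp] cp] <-]|_ [[p [Ap cp] <-] [q [Bq cq]]]].
  by split; exists p.
by move=> /(coord_inj cq cp) qp; exists p => //; do 2!split=> //; rewrite -qp.
Qed.

Fact manifold_open_bigU M (I : Type) (f : I -> set M) :
  (forall i, manifold_open (f i)) -> manifold_open (\bigcup_i f i).
Proof.
by move=> of_ c; rewrite setI_bigcupl image_bigcup; apply: bigcup_open => i _;
  exact: of_.
Qed.

HB.instance Definition _ M := isOpenTopological.Build (carrier M)
  (@manifold_openT M) (@manifold_openI M) (@manifold_open_bigU M).

End ManifoldTopology.

(* Hausdorffness is a separate condition, [hausdorff_space]. *)
Definition paracompact (T : topologicalType) : Prop :=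
  forall C : set (set T), C `<=` open -> \bigcup_(U in C) U = setT ->
  exists D : set (set T), [/\ D `<=` open, \bigcup_(V in D) V = setT,
    forall V, D V -> exists2 U, C U & V `<=` U &
    forall p : T, exists2 O, nbhs p O &
      finite_set [set V | D V /\ V `&` O !=set0]].

Section VectorFields.
Variables (R : realType) (m : nat) (M : manifold R m).

Definition trans (c c' : chart M) (x : 'rV[R]_m) : 'rV[R]_m :=
  coord c' (param c x).

(* A tangent vector at [p] is the family [v] of its coordinate vectors in the
   charts around [p]. *)
Definition tangent_at (p : M) (v : chart M -> 'rV[R]_m) : Prop :=
  forall c c', dom c p -> dom c' p -> v c' = 'D_(v c) (trans c c') (coord c p).

(* [X z c] is the coordinate vector of X at z in the chart c; it is relevant
   only when [dom c z]. A field is used on an open set W, and its values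
   outside W are irrelevant. *)
Definition field := M -> chart M -> 'rV[R]_m.

Implicit Types (W : set M) (X Y Z : field) (f : M -> R).

Definition field_eq W X Y : Prop :=
  forall z, W z -> forall c, dom c z -> X z c = Y z c.

Definition smooth_fun W f : Prop :=
  forall c, smooth (coord c @` (W `&` dom c)) (fun x => f (param c x)).

Definition vector_field W X : Prop :=
  (forall z, W z -> tangent_at z (X z)) /\
  forall c, smooth (coord c @` (W `&` dom c)) (fun x => X (param c x) c).

(* The derivative of f along X, computed in the chart c. *)
Definition lie_deriv X f (z : M) (c : chart M) : R :=
  'D_(X z c) (fun x => f (param c x)) (coord c z).

Definition lie_bracket X Y : field := fun z c =>
  'D_(X z c) (fun x => Y (param c x) c) (coord c z) -
  'D_(Y z c) (fun x => X (param c x) c) (coord c z).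

(* The coordinate vector field of the chart c with constant components v. *)
Definition coord_field (c : chart M) (v : 'rV[R]_m) : field := fun z c' =>
  'D_v (trans c c') (coord c z).

(* A Koszul connection, acting on vector fields over open subsets: by
   [conn_local] and bump functions this is the same as a connection on the
   global vector fields. *)
Record linear_connection (D : field -> field -> field) : Prop := {
  conn_field : forall W X Y, open W -> vector_field W X -> vector_field W Y ->
    vector_field W (D X Y);
  conn_local : forall W X X' Y Y', open W ->
    vector_field W X -> vector_field W Y ->
    field_eq W X X' -> field_eq W Y Y' -> field_eq W (D X Y) (D X' Y');
  conn_addl : forall W X X' Y, open W ->
    vector_field W X -> vector_field W X' -> vector_field W Y ->
    field_eq W (D (fun z c => X z c + X' z c) Y)
      (fun z c => D X Y z c + D X' Y z c);
  conn_scalel : forall W f X Y, open W ->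
    smooth_fun W f -> vector_field W X -> vector_field W Y ->
    field_eq W (D (fun z c => f z *: X z c) Y) (fun z c => f z *: D X Y z c);
  conn_addr : forall W X Y Y', open W ->
    vector_field W X -> vector_field W Y -> vector_field W Y' ->
    field_eq W (D X (fun z c => Y z c + Y' z c))
      (fun z c => D X Y z c + D X Y' z c);
  conn_leibniz : forall W f X Y, open W ->
    smooth_fun W f -> vector_field W X -> vector_field W Y ->
    field_eq W (D X (fun z c => f z *: Y z c))
      (fun z c => lie_deriv X f z c *: Y z c + f z *: D X Y z c)
}.

Definition curvature (D : field -> field -> field) X Y Z : field := fun z c =>
  D X (D Y Z) z c - D Y (D X Z) z c - D (lie_bracket X Y) Z z c.

End VectorFields.

Section TangentBundle.
Variables (R : realType) (n : nat) (M : manifold R n).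

(* The last field makes the family [vel] unique. *)
Record tvec := TVec {
  base : M;
  vel : chart M -> 'rV[R]_n;
  vel_tangent : tangent_at base vel;
  vel_out : forall c, ~ dom c base -> vel c = 0
}.

Lemma tvec_eq (u v : tvec) : base u = base v -> vel u = vel v -> u = v.
Proof.
case: u v => [p u tu ou] [q v tv ov] /= e1 e2.
by subst; congr TVec; exact: Prop_irrelevance.
Qed.

Definition tdom (c : chart M) : set tvec := [set z | dom c (base z)].

Definition tcoord (c : chart M) (z : tvec) : 'rV[R]_(n + n) :=
  row_mx (coord c (base z)) (vel z c).

Definition overlap (c c' : chart M) := coord c @` (dom c `&` dom c').

Lemma open_ov c c' : open (overlap c c').
Proof. exact: open_overlap. Qed.

Lemma overlapP c c' x : overlap c c' x <->
  [/\ dom c (param c x), dom c' (param c x) & coord c (param c x) = x].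
Proof.
split=> [[p [cp c'p] <-]|[cp c'p e]]; first by rewrite coordK.
by exists (param c x).
Qed.

Lemma trans_differentiable (c c' : chart M) x :
  overlap c c' x -> differentiable (trans c c') x.
Proof. exact: (@smooth_transition _ _ M c c' 1%N).1. Qed.

Lemma derive_trans_id (c : chart M) x y :
  overlap c c x -> 'D_y (trans c c) x = y.
Proof.
move=> ox; rewrite -[RHS](derive_id x y); apply: near_eq_derive.
apply: filterS (open_near (@open_ov c c) ox) => u.
by rewrite /trans => /overlapP[_ _ ->].
Qed.

Lemma derive_trans_comp (c c' c'' : chart M) x y :
  overlap c c' x -> overlap c c'' x ->
  'D_y (trans c c'') x = 'D_('D_y (trans c c') x) (trans c' c'') (trans c c' x).
Proof.
move=> ov1 ov2; have /overlapP[cx c'x ex] := ov1; have /overlapP[_ c''x _] := ov2.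
have ot : overlap c' c'' (trans c c' x).
  by rewrite /trans; exists (param c x).
rewrite -derive_comp; [|exact: trans_differentiable..].
apply: near_eq_derive; apply: filterS (open_near (@open_ov c c') ov1) => u.
by move=> /overlapP[_ c'u _]; rewrite /trans /= coordK.
Qed.

Definition tparam_vel (c : chart M) (w : 'rV[R]_(n + n)) (c' : chart M) :=
  if `[< overlap c c' (lsubmx w) >]
  then 'D_(rsubmx w) (trans c c') (lsubmx w) else 0.

Lemma tparam_vel_tangent c w :
  tangent_at (param c (lsubmx w)) (tparam_vel c w).
Proof.
move=> c' c'' c'p c''p; rewrite /tparam_vel.
have [ov1|nov1] := pselect (overlap c c' (lsubmx w)).
  have ov2 : overlap c c'' (lsubmx w).
    by move/overlapP: ov1 => [cp _ e]; apply/overlapP.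
  by rewrite (asboolT ov1) (asboolT ov2); exact: derive_trans_comp.
have nov2 : ~ overlap c c'' (lsubmx w).
  by move=> /overlapP[cp _ e]; apply: nov1; apply/overlapP.
by rewrite (asboolF nov1) (asboolF nov2) derive0.
Qed.

Lemma tparam_vel_out c w c' :
  ~ dom c' (param c (lsubmx w)) -> tparam_vel c w c' = 0.
Proof.
move=> nd; rewrite /tparam_vel; case: asboolP => // /overlapP[_ d _].
by case: nd.
Qed.

Definition tparam (c : chart M) (w : 'rV[R]_(n + n)) : tvec :=
  TVec (@tparam_vel_tangent c w) (@tparam_vel_out c w).

Lemma tdom_cover z : exists c, tdom c z.
Proof. exact: dom_cover (base z). Qed.

Lemma tcoordK c z : tdom c z -> tparam c (tcoord c z) = z.
Proof.
move=> cz; apply: tvec_eq; first by rewrite /= row_mxKl coordK.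
apply/funext => c'; rewrite /= /tparam_vel row_mxKl row_mxKr.
case: asboolP => [/overlapP[]|no].
  by rewrite coordK // => _ c'z _; rewrite [RHS](vel_tangent cz c'z).
rewrite vel_out // => c'z; apply: no; exists (base z) => //.
Qed.

Lemma toverlapE c c' :
  tcoord c @` (tdom c `&` tdom c') = [set w | overlap c c' (lsubmx w)].
Proof.
apply/seteqP; split=> [_ [z [cz c'z] <-]|w /= ow].
  by rewrite /= row_mxKl; exists (base z).
exists (tparam c w); first by move/overlapP: (ow) => [].
have oc : overlap c c (lsubmx w).
  by move/overlapP: (ow) => [? _ ?]; apply/overlapP.
rewrite /tcoord /= /tparam_vel (asboolT oc) derive_trans_id //.
by move/overlapP: ow => [_ _ ->]; rewrite hsubmxK.
Qed.

Lemma topen_overlap c c' : open (tcoord c @` (tdom c `&` tdom c')).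
Proof.
rewrite toverlapE; apply: (@open_comp _ _ lsubmx); last exact: open_ov.
by move=> w _; exact: continuous_lsubmx.
Qed.

Lemma tsmooth_transition c c' :
  smooth (tcoord c @` (tdom c `&` tdom c')) (fun w => tcoord c' (tparam c w)).
Proof.
move=> k; apply: Ck_ext (@topen_overlap c c') _ _; last first.
  rewrite toverlapE.
  exact: (smooth_tangent (@open_ov c c') (@smooth_transition _ _ M c c')).
move=> w; rewrite toverlapE => /= ow.
by rewrite /tcoord /= /tparam_vel (asboolT ow).
Qed.

(* The induced coordinates (x, y) are encoded as the block row [row_mx x y]. *)
Definition tangent_bundle : manifold R (n + n) :=
  Manifold tdom_cover tcoordK topen_overlap tsmooth_transition.

End TangentBundle.

Section NonlinearConnection.
Variables (R : realType) (n : nat) (M : manifold R n).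
Local Notation TM := (tangent_bundle M).
(* [N c z a mu] is $N^a_\mu$ at z in the coordinates induced by the chart c. *)
Variable N : chart M -> TM -> 'M[R]_n.

Definition dx (c : chart TM) (mu : 'I_n) : field TM :=
  coord_field c (row_mx (delta_mx 0 mu) 0).

Definition dy (c : chart TM) (a : 'I_n) : field TM :=
  coord_field c (row_mx 0 (delta_mx 0 a)).

Definition delta (c : chart TM) (mu : 'I_n) : field TM := fun z c' =>
  dx c mu z c' - \sum_(a < n) N c z a mu *: dy c a z c'.

(* The transformation law of the coefficients is equivalent to that of the
   adapted frame, $\delta_\mu = (\partial x'^\nu/\partial x^\mu) \delta'_\nu$. *)
Definition nonlinear_connection : Prop :=
  (forall c a mu, smooth_fun (dom c) (fun z : TM => N c z a mu)) /\
  forall (c c' : chart TM) mu, field_eq (dom c `&` dom c')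
    (delta c mu)
    (fun z c'' => \sum_(nu < n)
       ('D_(delta_mx 0 mu) (@trans _ _ M c c') (@coord _ _ M c (base z))) 0 nu
         *: delta c' nu z c'').

(* The components of X in the adapted frame of the chart c, see
   [adapted_frameE]. *)
Definition hcomp (c : chart TM) (X : field TM) (z : TM) (alpha : 'I_n) : R :=
  lsubmx (X z c) 0 alpha.

Definition vcomp (c : chart TM) (X : field TM) (z : TM) (a : 'I_n) : R :=
  rsubmx (X z c) 0 a + \sum_(mu < n) N c z a mu * lsubmx (X z c) 0 mu.

Definition hpart (X : field TM) : field TM := fun z c =>
  \sum_(alpha < n) hcomp c X z alpha *: delta c alpha z c.

Definition vpart (X : field TM) : field TM := fun z c =>
  \sum_(a < n) vcomp c X z a *: dy c a z c.

Lemma adapted_frameE (X : field TM) (z : TM) (c : chart TM) : dom c z ->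
  X z c = \sum_(alpha < n) hcomp c X z alpha *: delta c alpha z c
        + \sum_(a < n) vcomp c X z a *: dy c a z c.
Proof.
move=> cz.
have frame v : coord_field c v z c = v.
  by apply: (@derive_trans_id _ _ TM); exists z.
have dxE mu : dx c mu z c = row_mx (delta_mx 0 mu) 0 by exact: frame.
have dyE a : dy c a z c = row_mx 0 (delta_mx 0 a) by exact: frame.
have deltaE : \sum_(alpha < n) hcomp c X z alpha *: delta c alpha z c =
    row_mx (lsubmx (X z c)) 0 - \sum_(a < n)
      (\sum_(mu < n) N c z a mu * lsubmx (X z c) 0 mu) *: dy c a z c.
  under eq_bigr do rewrite scalerBr scaler_sumr.
  rewrite sumrB exchange_big /=; congr (_ - _).
    under eq_bigr do rewrite dxE scale_row_mx scaler0.
    rewrite [X in row_mx X _]row_sum_delta.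
    elim/big_rec2: _ => [|mu u v _ ->]; first by rewrite row_mx0.
    by rewrite add_row_mx addr0.
  apply: eq_bigr => a _; rewrite scaler_suml; apply: eq_bigr => mu _.
  by rewrite scalerA mulrC.
rewrite deltaE; under [X in _ + X]eq_bigr do rewrite scalerDl.
rewrite big_split /= addrACA -addrA [X in _ + X]addrC addNr add0r.
have -> : \sum_(a < n) rsubmx (X z c) 0 a *: dy c a z c =
    row_mx 0 (rsubmx (X z c)).
  under eq_bigr do rewrite dyE scale_row_mx scaler0.
  rewrite [X in row_mx _ X]row_sum_delta.
  elim/big_rec2: _ => [|a u v _ ->]; first by rewrite row_mx0.
  by rewrite add_row_mx addr0.
by rewrite add_row_mx addr0 add0r hsubmxK.
Qed.

Definition horizontal (W : set TM) (X : field TM) : Prop :=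
  forall z, W z -> forall c, dom c z -> exists u : 'I_n -> R,
    X z c = \sum_(alpha < n) u alpha *: delta c alpha z c.

Definition vertical (W : set TM) (X : field TM) : Prop :=
  forall z, W z -> forall c, dom c z -> exists w : 'I_n -> R,
    X z c = \sum_(a < n) w a *: dy c a z c.

Definition d_connection (D : field TM -> field TM -> field TM) : Prop :=
  [/\ linear_connection D,
    forall W X Y, open W -> vector_field W X -> vector_field W Y ->
      horizontal W Y -> horizontal W (D X Y) &
    forall W X Y, open W -> vector_field W X -> vector_field W Y ->
      vertical W Y -> vertical W (D X Y)].

Definition parallel (D : field TM -> field TM -> field TM) (Y : field TM) :
    Prop :=
  forall W X, open W -> vector_field W X -> field_eq W (D X Y) (fun _ _ => 0).

Definition EAP_space (lambda : 'I_n -> field TM) : Prop :=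
  [/\ forall i, vector_field setT (lambda i),
    forall (z : TM) (c : chart TM), dom c z ->
      row_free (\matrix_(i < n) hpart (lambda i) z c) &
    forall (z : TM) (c : chart TM), dom c z ->
      row_free (\matrix_(i < n) vpart (lambda i) z c)].

Definition canonical_d_connection (lambda : 'I_n -> field TM)
    (D : field TM -> field TM -> field TM) : Prop :=
  [/\ d_connection D,
    forall i, parallel D (hpart (lambda i)) &
    forall i, parallel D (vpart (lambda i))].

Section CurvatureComponents.
Variable D : field TM -> field TM -> field TM.
Implicit Types (c : chart TM) (z : TM).

(* $R^\alpha_{\beta\mu\nu}$ and $R^a_{b\mu\nu}$ *)
Definition Rh c z (alpha beta mu nu : 'I_n) : R :=
  hcomp c (curvature D (delta c mu) (delta c nu) (delta c beta)) z alpha.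
Definition Rv c z (a b mu nu : 'I_n) : R :=
  vcomp c (curvature D (delta c mu) (delta c nu) (dy c b)) z a.

(* $P^\alpha_{\beta\nu e}$ and $P^a_{b\nu e}$ *)
Definition Ph c z (alpha beta nu e : 'I_n) : R :=
  hcomp c (curvature D (dy c e) (delta c nu) (delta c beta)) z alpha.
Definition Pv c z (a b nu e : 'I_n) : R :=
  vcomp c (curvature D (dy c e) (delta c nu) (dy c b)) z a.

(* $S^\alpha_{\beta be}$ and $S^a_{bde}$ *)
Definition Sh c z (alpha beta b e : 'I_n) : R :=
  hcomp c (curvature D (dy c b) (dy c e) (delta c beta)) z alpha.
Definition Sv c z (a b d e : 'I_n) : R :=
  vcomp c (curvature D (dy c d) (dy c e) (dy c b)) z a.

End CurvatureComponents.

End NonlinearConnection.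

(* Main.v *)
Require Import Defs.
From HB Require Import structures.
From mathcomp Require Import all_boot all_order all_algebra.
From mathcomp Require Import all_classical all_reals.
From mathcomp Require Import topology normedtype landau derive.

(* The horizontal and vertical parts of the lambda_i form a global frame (e_k)
   of parallel fields. Every field on an open set is Z = sum_k f_k e_k with
   smooth f_k, so the Leibniz rule gives D_Y Z = sum_k (Y f_k) e_k and
   D_X D_Y Z = sum_k (X (Y f_k)) e_k. Hence the curvature applied to Z is
   sum_k (X (Y f_k) - Y (X f_k) - [X, Y] f_k) e_k = 0, the last step being the
   symmetry of second derivatives. The components are the special cases where
   X, Y, Z belong to an adapted frame. *)

Set Implicit Arguments.
Unset Strict Implicit.
Unset Printing Implicit Defensive.

Import Order.TTheory GRing.Theory Num.Theory.
Import numFieldNormedType.Exports.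
(* [coord] is also the name of a function on vector spaces. *)
Import Defs.

Local Open Scope classical_set_scope.
Local Open Scope ring_scope.

(** * Calculus of class C^k maps *)

Section Calculus.
Variable R : realType.
Implicit Types V W : normedModType R.

Lemma Ck_subset V W k (A B : set V) (f : V -> W) :
  A `<=` B -> Ck k B f -> Ck k A f.
Proof.
move=> AB; elim: k f => [|k IH] f; first by move=> cf x /AB; exact: cf.
by move=> [df Df]; split=> [x /AB|v]; [exact: df|exact/IH/Df].
Qed.

Lemma Ck_bigsum V W k (A : set V) (I : Type) (r : seq I) (P : pred I)
    (f : I -> V -> W) : open A -> (forall i, Ck k A (f i)) ->
  Ck k A (fun x => \sum_(i <- r | P i) f i x).
Proof.
move=> oA cf; elim: r => [|i r IH].
  by apply: Ck_ext (Ck_cst k A (0 : W)) => // x _; rewrite big_nil.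
case Pi: (P i); last by apply: Ck_ext IH => // x _; rewrite big_cons Pi.
by apply: Ck_ext (Ck_add oA (cf i) IH) => // x _; rewrite big_cons Pi.
Qed.

Lemma Ck_mul V k (A : set V) (f g : V -> R) : open A ->
  Ck k A f -> Ck k A g -> Ck k A (fun x => f x * g x).
Proof. exact: Ck_scale. Qed.

Lemma Ck_bigprod V k (A : set V) (I : Type) (r : seq I) (P : pred I)
    (f : I -> V -> R) : open A -> (forall i, Ck k A (f i)) ->
  Ck k A (fun x => \prod_(i <- r | P i) f i x).
Proof.
move=> oA cf; elim: r => [|i r IH].
  by apply: Ck_ext (Ck_cst k A (1 : R)) => // x _; rewrite big_nil.
case Pi: (P i); last by apply: Ck_ext IH => // x _; rewrite big_cons Pi.
by apply: Ck_ext (Ck_mul oA (cf i) IH) => // x _; rewrite big_cons Pi.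
Qed.

(** Induction on k: the derivative $-h^{-2} D_v h$ contains only [h^-1], of class C^k by the
    induction hypothesis, and a derivative of [h]. *)
Lemma Ck_inv V k (A : set V) (h : V -> R) : open A ->
  (forall x, A x -> h x != 0) -> Ck k A h -> Ck k A (fun x => (h x)^-1).
Proof.
move=> oA h0; elim: k => [|k IH].
  by move=> ch x Ax; apply: cvgV; [exact: h0|exact: ch].
move=> ckh; have ckV := IH (Ck_S ckh); have [dh Dh] := ckh.
split=> [x Ax|v]; first by apply: differentiableV; [exact: dh|exact: h0].
apply: Ck_ext (Ck_mul oA (Ck_mul oA (Ck_cst k A (-1 : R)) (Ck_mul oA ckV ckV))
  (Dh v)) => // x Ax.
rewrite deriveV ?h0 //; last exact/diff_derivable/dh.
by rewrite -expr2 exprVn mulN1r.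
Qed.

Lemma Ck_det V k (A : set V) n (B : V -> 'M[R]_n) : open A ->
  (forall i j, Ck k A (fun x => B x i j)) -> Ck k A (fun x => \det (B x)).
Proof.
move=> oA cB; apply: Ck_bigsum => // s.
apply: Ck_mul => //; first exact: Ck_cst.
by apply: Ck_bigprod => // i; exact: cB.
Qed.

(** Cramer's rule: each entry is a cofactor, polynomial in the entries of [B], divided by the
    nonvanishing determinant. *)
Lemma Ck_invmx V k (A : set V) n (B : V -> 'M[R]_n) : open A ->
  (forall x, A x -> B x \in unitmx) ->
  (forall i j, Ck k A (fun x => B x i j)) ->
  forall i j, Ck k A (fun x => invmx (B x) i j).
Proof.
move=> oA uB cB i j.
have cdet : Ck k A (fun x => (\det (B x))^-1).
  apply: Ck_inv => //; last exact: Ck_det.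
  by move=> x /uB; rewrite unitmxE unitfE.
have cadj : Ck k A (fun x => \adj (B x) i j).
  apply: (@Ck_ext _ _ _ k A (fun x =>
    (-1) ^+ (j + i) * \det (row' j (col' i (B x))))) => //.
    by move=> x _; rewrite mxE.
  apply: Ck_mul => //; first exact: Ck_cst.
  apply: Ck_det => // i' j'.
  by apply: Ck_ext (cB (lift j i') (lift i j')) => // x _; rewrite !mxE.
apply: Ck_ext (Ck_mul oA cdet cadj) => // x Ax.
by rewrite /invmx (uB x Ax) [RHS]mxE.
Qed.

(** * Coordinates of row vectors, variable directions and composition *)

Section Coordinates.
Variable m : nat.

(** A named function, so that it can carry the structure of a linear map and enter [Ck_postcomp] and
    [derive_comp]. *)
Definition rV_coord (j : 'I_m) (v : 'rV[R]_m) : R := v 0 j.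

Lemma rV_coord_is_linear j : linear_for *%R (rV_coord j).
Proof. by move=> a x y; rewrite /rV_coord !mxE. Qed.

HB.instance Definition _ j :=
  GRing.isLinear.Build _ _ _ _ (rV_coord j) (rV_coord_is_linear j).

Lemma rV_coord_continuous j : continuous (rV_coord j).
Proof. exact: coord_continuous. Qed.

Lemma Ck_coord V k (A : set V) (f : V -> 'rV[R]_m) j : open A ->
  Ck k A f -> Ck k A (fun x => f x 0 j).
Proof.
move=> oA cf.
exact: (@Ck_postcomp _ _ _ _ k A f (rV_coord j) oA (@rV_coord_continuous j) cf).
Qed.

Lemma derive_coord V (f : V -> 'rV[R]_m) x v j : differentiable f x ->
  'D_v (fun y => f y 0 j) x = ('D_v f x) 0 j.
Proof.
move=> df.
have := @derive_comp _ _ _ _ f (rV_coord j) x v df.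
rewrite derive_lin; last exact: rV_coord_continuous.
by apply; exact/linear_differentiable/rV_coord_continuous.
Qed.

Lemma derive_rowE W (F : 'rV[R]_m -> W) x v : differentiable F x ->
  'D_v F x = \sum_j v 0 j *: 'D_(delta_mx 0 j) F x.
Proof.
move=> dF; rewrite (deriveE _ dF) [X in 'd F _ X]row_sum_delta linear_sum.
by apply: eq_bigr => j _; rewrite linearZ /= -deriveE.
Qed.

(** [Ck] speaks of derivatives in constant directions only; expanding [X x] in the standard basis
    reduces the variable direction to these. *)
Lemma Ck_directional W k (A : set 'rV[R]_m) (X : 'rV[R]_m -> 'rV[R]_m)
    (F : 'rV[R]_m -> W) : open A -> Ck k A X -> Ck k.+1 A F ->
  Ck k A (fun x => 'D_(X x) F x).
Proof.
move=> oA cX [dF DF].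
have cs := @Ck_bigsum _ W k A _ (index_enum 'I_m) xpredT
  (fun j x => X x 0 j *: 'D_(delta_mx 0 j) F x) oA.
apply: Ck_ext (cs _) => //.
  by move=> x Ax; rewrite [RHS]derive_rowE //; exact: dF.
by move=> j; apply: Ck_scale => //; [exact: Ck_coord|exact: DF].
Qed.

(** Induction on k with [g] general: by the chain rule the derivative is $\sum_j (D_v f)_j \cdot
    (\partial_j g) \circ f$, where [f] is still the inner map and the outer maps have lost one
    order. *)
Lemma Ck_comp V W k (A : set V) (B : set 'rV[R]_m) (f : V -> 'rV[R]_m)
    (g : 'rV[R]_m -> W) : open A -> (forall x, A x -> B (f x)) ->
  Ck k A f -> Ck k B g -> Ck k A (g \o f).
Proof.
move=> oA AB; elim: k g => [|k IH] g.
  by move=> cf cg x Ax; apply: continuous_comp; [exact: cf|exact/cg/AB].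
move=> ckf [dg Dg]; have [df Df] := ckf.
split=> [x Ax|v].
  by apply: differentiable_comp; [exact: df|exact/dg/AB].
have cs := @Ck_bigsum _ W k A _ (index_enum 'I_m) xpredT
  (fun j x => ('D_v f x) 0 j *: 'D_(delta_mx 0 j) g (f x)) oA.
apply: Ck_ext (cs _) => //.
  move=> x Ax; rewrite [RHS]derive_comp; [|exact: df|exact/dg/AB].
  by rewrite [RHS]derive_rowE //; exact/dg/AB.
move=> j; apply: Ck_scale => //; first exact/Ck_coord/Df.
by apply: IH (Dg _); exact: Ck_S.
Qed.

End Coordinates.

End Calculus.

(** * Symmetry of second derivatives *)

Section Schwarz.
Variable R : realType.
Implicit Types V W : normedModType R.

(** The difference quotients of both sides coincide; restricting [F] to a line makes the
    one-variable mean value theorem available. *)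
Lemma is_derive_line V W (F : V -> W) q u (s : R) :
  derivable F (q + s *: u) u ->
  is_derive s 1 (fun t : R => F (q + t *: u)) ('D_u F (q + s *: u)).
Proof.
have lineE : (fun h : R => h^-1 *:
      (((fun t : R => F (q + t *: u)) \o shift s) (h *: 1) - F (q + s *: u))) =
    (fun h => h^-1 *: ((F \o shift (q + s *: u)) (h *: u) - F (q + s *: u))).
  apply/funext => h /=; congr (_ *: (F _ - _)).
  by rewrite [h *: 1]mulr1 scalerDl addrCA.
by move=> dF; split; rewrite /derivable /derive lineE.
Qed.

Lemma half_dist_absurd (a b y : R) :
  `|a - y| < `|a - b| / 2 -> `|b - y| < `|a - b| / 2 -> False.
Proof.
move=> ay /(ltrD ay); rewrite -splitr (distrC b) ltNge => /negP; apply.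
exact: ler_distD.
Qed.

(* The mean value theorem is applied in the direction [u], then [v]; exchanging
   the directions does not change the left-hand side. *)
Lemma second_difference V (A : set V) (F : V -> R) p u v (h : R) : 0 < h ->
  (forall s t : R, 0 <= s <= h -> 0 <= t <= h -> A (p + s *: u + t *: v)) ->
  Ck 2 A F ->
  exists s t : R, [/\ 0 <= s <= h, 0 <= t <= h &
    F (p + h *: u + h *: v) - F (p + h *: u) - (F (p + h *: v) - F p) =
    h ^+ 2 * 'D_v ('D_u F) (p + s *: u + t *: v)].
Proof.
move=> h0 inA [dF DF].
have h0h : 0 <= h <= h by rewrite lexx ltW.
have h00 : 0 <= (0 : R) <= h by rewrite lexx ltW.
pose g (s : R) := F (p + h *: v + s *: u) - F (p + s *: u).
pose dg (s : R) := 'D_u F (p + h *: v + s *: u) - 'D_u F (p + s *: u).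
have line q w (s : R) (G : V -> R) : (forall y, A y -> differentiable G y) ->
    A (q + s *: w) ->
    is_derive s 1 (fun t : R => G (q + t *: w)) ('D_w G (q + s *: w)).
  by move=> dG Aq; apply: is_derive_line; exact/diff_derivable/dG.
have g' s : s \in `[0, h]%R -> is_derive s 1 g (dg s).
  rewrite in_itv /= => hs; apply: is_deriveB; apply: line => //.
    by rewrite addrAC; exact: inA.
  by rewrite -[_ + _]addr0 -(scale0r v); exact: inA.
have [s hs gE] : exists2 s, s \in `[0, h]%R & g h - g 0 = dg s * (h - 0).
  have cg : {within `[0, h], continuous g}.
    by apply: derivable_within_continuous => s /g' [].
  have og s : s \in `]0, h[%R -> is_derive s 1 g (dg s).
    by move=> hs; apply: g'; exact: subset_itv_oo_cc hs.
  exact: MVT_segment (ltW h0) og cg.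
move: (hs); rewrite in_itv /= => hs'.
(* At the point [s] just found, [dg s] is the increment [k h - k 0], to which the mean value theorem
   applies again. *)
pose k (t : R) := 'D_u F (p + s *: u + t *: v).
pose dk (t : R) := 'D_v ('D_u F) (p + s *: u + t *: v).
have k' t : t \in `[0, h]%R -> is_derive t 1 k (dk t).
  rewrite in_itv /= => ht.
  by apply: line; [exact: (DF u).1|exact: inA].
have [t ht kE] : exists2 t, t \in `[0, h]%R & k h - k 0 = dk t * (h - 0).
  have ck : {within `[0, h], continuous k}.
    by apply: derivable_within_continuous => t /k' [].
  have ok t : t \in `]0, h[%R -> is_derive t 1 k (dk t).
    by move=> ht; apply: k'; exact: subset_itv_oo_cc ht.
  exact: MVT_segment (ltW h0) ok ck.
exists s, t; split=> //.
rewrite subr0 in gE; rewrite subr0 in kE.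
have -> : h ^+ 2 * dk t = dg s * h.
  rewrite expr2 mulrAC [h * dk t]mulrC -kE; congr (_ * _).
  by rewrite /k /dg scale0r addr0 [p + s *: u + _]addrAC.
by rewrite -gE /g !scale0r !addr0 [p + h *: v + _]addrAC.
Qed.

(** If the mixed derivatives [a] and [b] differ at [p], continuity keeps them within half their
    distance of [a] and [b] near [p]. Yet [second_difference], used in both orders on a small
    parallelogram, makes a value of one equal to a value of the other. *)
Lemma Schwarz V (A : set V) (F : V -> R) p u v : open A -> A p ->
  Ck 2 A F -> 'D_u ('D_v F) p = 'D_v ('D_u F) p.
Proof.
move=> oA Ap cF; have [_ DF] := cF.
apply/eqP; rewrite -subr_eq0 -normr_le0 leNgt; apply/negP.
set a := 'D_u _ p; set b := 'D_v _ p => ab.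
pose e := `|a - b| / 2.
have e0 : 0 < e by rewrite divr_gt0.
have na : \forall y \near p, `|a - 'D_u ('D_v F) y| < e.
  by have /cvgrPdist_lt/(_ e e0) := (DF v).2 u p Ap.
have nb : \forall y \near p, `|b - 'D_v ('D_u F) y| < e.
  by have /cvgrPdist_lt/(_ e e0) := (DF u).2 v p Ap.
have [r /= r0 rB] : nbhs_ball p (fun y => A y /\
    `|a - 'D_u ('D_v F) y| < e /\ `|b - 'D_v ('D_u F) y| < e).
  by apply/nbhs_ballP; apply: filterI (open_near oA Ap) (filterI na nb).
(* With this size, $\|s x + t y\| \le h(\|u\| + \|v\|) < r$; the summand 1 makes the denominator
   positive and the last inequality strict. *)
pose h := r / (`|u| + `|v| + 1).
have uv0 : 0 < `|u| + `|v| + 1 by rewrite ltr_wpDl // addr_ge0.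
have h0 : 0 < h by rewrite divr_gt0.
have inb (x y : V) (s t : R) : `|x| + `|y| = `|u| + `|v| ->
    0 <= s <= h -> 0 <= t <= h -> ball p r (p + s *: x + t *: y).
  move=> xy /andP[s0 sh] /andP[t0 th]; rewrite -ball_normE /ball_ /=.
  rewrite -addrA opprD addrA subrr add0r normrN.
  apply: le_lt_trans (ler_normD _ _) _.
  rewrite !normrZ (ger0_norm s0) (ger0_norm t0).
  have : s * `|x| + t * `|y| <= h * (`|u| + `|v|).
    by rewrite -xy mulrDr lerD // ler_wpM2r.
  move/le_lt_trans; apply.
  by rewrite -[ltRHS](divfK (lt0r_neq0 uv0)) ltr_pM2l // ltrDl.
have inA x y s t xy hs ht := (rB _ (inb x y s t xy hs ht)).1.
have [s [t [hs ht E1]]] :=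
  second_difference h0 (fun s t => inA u v s t erefl) cF.
have [s' [t' [hs' ht' E2]]] :=
  second_difference h0 (fun s t => inA v u s t (addrC _ _)) cF.
(* Multiplied by $h^2$, both sides are the same second difference, which is symmetric in [u] and
   [v]. *)
have E : 'D_v ('D_u F) (p + s *: u + t *: v) =
         'D_u ('D_v F) (p + s' *: v + t' *: u).
  have h2 : h ^+ 2 != 0 by rewrite lt0r_neq0 // exprn_gt0.
  apply/(mulfI h2)/(etrans (esym E1))/(etrans _ E2).
  by rewrite (addrAC p (h *: u)) !opprB addrACA [RHS]addrACA [- _ + _]addrC.
have [_ [_ lb]] := rB _ (inb u v s t erefl hs ht).
have [_ [la _]] := rB _ (inb v u s' t' (addrC _ _) hs' ht').
rewrite E in lb; exact: half_dist_absurd la lb.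
Qed.

End Schwarz.

(** * Second derivatives along variable directions and their commutator *)

Section Commutator.
Variables (R : realType) (m : nat).
Implicit Type W : normedModType R.

(** Taken coordinate by coordinate, since [Schwarz] rests on the mean value theorem for real values.
    It will be applied to transition maps. *)
Lemma Schwarz_rV k (A : set 'rV[R]_m) (F : 'rV[R]_m -> 'rV[R]_k) p u v :
  open A -> A p -> Ck 2 A F -> 'D_u ('D_v F) p = 'D_v ('D_u F) p.
Proof.
move=> oA Ap cF; have [dF DF] := cF.
have coordE i u' v' : ('D_u' ('D_v' F) p) 0 i =
    'D_u' ('D_v' (fun x => F x 0 i)) p.
  rewrite -derive_coord; last exact: (DF v').1.
  apply: near_eq_derive; apply: filterS (open_near oA Ap) => y Ay.
  by rewrite derive_coord //; exact: dF.
apply/rowP => i.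
have cFi : Ck 2 A (fun x => F x 0 i) by exact: Ck_coord.
apply: etrans (coordE i u v) (etrans _ (esym (coordE i v u))).
exact: Schwarz u v oA Ap cFi.
Qed.

(** The product rule for $\sum_j X^j \partial_j F$: one term differentiates the direction, the other
    freezes it at [p]. *)
Lemma derive_directional W (A : set 'rV[R]_m) (F : 'rV[R]_m -> W)
    (X : 'rV[R]_m -> 'rV[R]_m) p w :
  open A -> A p -> Ck 2 A F -> differentiable X p ->
  'D_w (fun x => 'D_(X x) F x) p = 'D_('D_w X p) F p + 'D_w ('D_(X p) F) p.
Proof.
move=> oA Ap [dF DF] dX.
pose G (Y : 'rV[R]_m -> 'rV[R]_m) j x := Y x 0 j *: 'D_(delta_mx 0 j) F x.
have dc (Y : 'rV[R]_m -> 'rV[R]_m) j : differentiable Y p ->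
    differentiable (fun x => Y x 0 j) p.
  move=> dY; apply: (@differentiable_comp _ _ _ _ Y (@rV_coord R m j)) => //.
  exact/linear_differentiable/rV_coord_continuous.
have GE (Y : 'rV[R]_m -> 'rV[R]_m) : differentiable Y p ->
    'D_w (fun x => 'D_(Y x) F x) p = 'D_('D_w Y p) F p +
      \sum_j Y p 0 j *: 'D_w ('D_(delta_mx 0 j) F) p.
  move=> dY.
  have dG j := differentiable_scale (dc _ j dY) ((DF (delta_mx 0 j)).1 _ Ap).
  transitivity ('D_w (\sum_j G Y j) p).
    apply: near_eq_derive; apply: filterS (open_near oA Ap) => y Ay.
    by rewrite fct_sumE derive_rowE //; exact: dF.
  rewrite derive_sum; last by move=> j; exact/diff_derivable/(dG j).1.
  rewrite [X in _ = X + _]derive_rowE; last exact: dF.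
  rewrite -big_split; apply: eq_bigr => j _ /=.
  rewrite (deriveE _ (dG j).1) (dG j).2 addrC -deriveE; last exact: (DF _).1.
  by rewrite -deriveE ?derive_coord //; exact: dc.
(* For the constant direction [cst (X p)] the first term of [GE] vanishes, which identifies the
   remaining sum. *)
have dXp : differentiable (cst (X p)) p by exact: differentiable_cst.
rewrite (GE X dX) [X in _ = _ + X](GE (cst (X p)) dXp).
by rewrite derive_cst derive0 add0r.
Qed.

(** By [derive_directional] the second-order terms cancel and the first-order terms combine by
    linearity of the differential. Symmetry at [p] is a hypothesis, so that real functions and
    transition maps are both covered. *)
Lemma derive_commutator W (A : set 'rV[R]_m) (F : 'rV[R]_m -> W)
    (X Y : 'rV[R]_m -> 'rV[R]_m) p :
  open A -> A p -> Ck 2 A F -> differentiable X p -> differentiable Y p ->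
  'D_(X p) ('D_(Y p) F) p = 'D_(Y p) ('D_(X p) F) p ->
  'D_(X p) (fun x => 'D_(Y x) F x) p - 'D_(Y p) (fun x => 'D_(X x) F x) p =
  'D_('D_(X p) Y p - 'D_(Y p) X p) F p.
Proof.
move=> oA Ap cF dX dY sym; have dF := cF.1 _ Ap.
have EX := derive_directional (X p) oA Ap cF dY.
have EY := derive_directional (Y p) oA Ap cF dX.
apply: etrans (congr2 (fun a b => a - b) EX EY) _; move: sym.
move: ('D_(X p) ('D_(Y p) F) p) ('D_(Y p) ('D_(X p) F) p) => c d ->.
have subDD (a b : W) : a + d - (b + d) = a - b.
  by rewrite opprD addrACA subrr addr0.
have dE v : 'D_v F p = 'd F p v by exact: deriveE.
apply: etrans (subDD _ _) (etrans (congr2 (fun a b => a - b) (dE _) (dE _)) _).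
exact: etrans (esym (linearB ('d F p) _ _)) (esym (dE _)).
Qed.

End Commutator.

(** * Fields and functions on a manifold *)

Section VectorFieldCalculus.
Variables (R : realType) (m : nat) (M : manifold R m).
Implicit Types (W : set M) (X Y Z : field M) (f : M -> R) (c : chart M).

Lemma open_coord_image W c : open W -> open (coord c @` (W `&` dom c)).
Proof. by move=> oW; exact: oW. Qed.

Lemma open_dom c : open (dom c).
Proof. by move=> c'; rewrite setIC; exact: open_overlap. Qed.

(** Used below [near_eq_derive]: under a derivative, an expression may be rewritten by identities
    valid only on [W] and in the chart. *)
Lemma near_param W c z : open W -> W z -> dom c z ->
  \forall x \near coord c z,
    [/\ W (param c x), dom c (param c x) & coord c (param c x) = x].
Proof.
move=> oW Wz cz; have oA := @open_coord_image W c oW.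
have Az : (coord c @` (W `&` dom c)) (coord c z) by exists z.
apply: filterS (open_near oA Az) => _ [p [Wp cp] <-].
by rewrite coordK.
Qed.

Lemma trans_differentiable_at c c' z : dom c z -> dom c' z ->
  differentiable (trans c c') (coord c z).
Proof. by move=> cz c'z; apply: trans_differentiable; exists z. Qed.

Lemma tangent_at_sum z (I : Type) (r : seq I) (a : I -> R)
    (v : I -> chart M -> 'rV[R]_m) : (forall i, tangent_at z (v i)) ->
  tangent_at z (fun c => \sum_(i <- r) a i *: v i c).
Proof.
move=> tv c c' cz c'z; have dT := trans_differentiable_at cz c'z.
rewrite (deriveE _ dT) linear_sum; apply: eq_bigr => i _.
by rewrite linearZ /= -deriveE // (tv i c c').
Qed.

Lemma vector_field_sub W W' X : W `<=` W' -> vector_field W' X ->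
  vector_field W X.
Proof.
move=> WW' [tX cX]; split=> [z /WW'|c k]; first exact: tX.
apply: Ck_subset (cX c k) => _ [p [Wp cp] <-].
by exists p => //; split=> //; exact: WW'.
Qed.

Lemma smooth_field_differentiable W X c z : vector_field W X -> W z ->
  dom c z -> differentiable (fun x => X (param c x) c) (coord c z).
Proof. by move=> [_ cX] Wz cz; apply: (cX c 1%N).1; exists z. Qed.

Lemma smooth_fun_differentiable W f c z : smooth_fun W f -> W z ->
  dom c z -> differentiable (fun x => f (param c x)) (coord c z).
Proof. by move=> cf Wz cz; apply: (cf c 1%N).1; exists z. Qed.

Lemma vector_field_eq W X Y : open W -> field_eq W X Y ->
  vector_field W X -> vector_field W Y.
Proof.
move=> oW XY [tX cX]; split=> [z Wz c c' cz c'z|c k].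
  by rewrite -!XY //; exact: tX.
apply: Ck_ext (cX c k); first exact: open_coord_image.
by move=> _ [p [Wp cp] <-]; rewrite XY coordK.
Qed.

Lemma vector_fieldB W X Y : open W -> vector_field W X -> vector_field W Y ->
  vector_field W (fun z c => X z c - Y z c).
Proof.
move=> oW [tX cX] [tY cY]; split=> [z Wz c c' cz c'z|c k].
  have dT := trans_differentiable_at cz c'z.
  rewrite (deriveE _ dT) linearB /= -!deriveE // (tX z Wz c c') //.
  by rewrite (tY z Wz c c').
have oA := @open_coord_image W c oW.
apply: Ck_ext (Ck_add oA (cX c k) (Ck_scale oA (Ck_cst k _ (-1 : R)) (cY c k))).
  exact: oA.
by move=> x _; rewrite fctE scaleN1r.
Qed.

Lemma coord_fieldE c v z : dom c z -> coord_field c v z c = v.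
Proof. by move=> cz; apply: derive_trans_id; exists z. Qed.

(** Tangency is the chain rule for transition maps. In a chart [c'] the field is the derivative of
    [trans c c'] composed with [trans c' c], hence smooth. *)
Lemma coord_vector_field c v : vector_field (dom c) (coord_field c v).
Proof.
split=> [z cz c' c'' c'z c''z|c' k].
  have TE : trans c c' (coord c z) = coord c' z by rewrite /trans coordK.
  by rewrite /coord_field -TE; apply: derive_trans_comp; exists z.
have oA : open (coord c' @` (dom c `&` dom c')).
  by rewrite setIC; exact: open_overlap.
apply: (Ck_comp (B := coord c @` (dom c `&` dom c')) (f := trans c' c)
  (g := 'D_v (trans c c')) oA).
- by move=> _ [p [cp c'p] <-]; rewrite /trans coordK //; exists p.
- by rewrite setIC; exact: (@smooth_transition _ _ M c' c k).
- exact: (@smooth_transition _ _ M c c' k.+1).2.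
Qed.

Lemma vector_field_sum W (I : Type) (r : seq I) (f : I -> M -> R)
    (X : I -> field M) : open W -> (forall i, smooth_fun W (f i)) ->
  (forall i, vector_field W (X i)) ->
  vector_field W (fun z c => \sum_(i <- r) f i z *: X i z c).
Proof.
move=> oW cf cX; split=> [z Wz|c k].
  by apply: tangent_at_sum => i; exact: (cX i).1.
apply: Ck_bigsum; first exact: open_coord_image.
move=> i; apply: Ck_scale; first exact: open_coord_image.
  exact: cf.
exact: (cX i).2.
Qed.

(** The chain rule through [trans c c'] matches the transformation law of the coordinate vector of
    [X]. *)
Lemma lie_deriv_chart W X f c c' z : open W -> vector_field W X ->
  smooth_fun W f -> W z -> dom c z -> dom c' z ->
  lie_deriv X f z c = lie_deriv X f z c'.
Proof.
move=> oW [tX _] cf Wz cz c'z; rewrite /lie_deriv.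
have dT := trans_differentiable_at cz c'z.
have df := smooth_fun_differentiable cf Wz c'z.
have TE : trans c c' (coord c z) = coord c' z by rewrite /trans coordK.
have := @derive_comp _ _ _ _ (trans c c') (fun x => f (param c' x))
  (coord c z) (X z c) dT.
rewrite TE -(tX z Wz c c' cz c'z) => <- //.
apply: near_eq_derive.
have := near_param (openI oW (@open_dom c')) (conj Wz c'z) cz.
by apply: filterS => x [[_ c'x] _ _]; rewrite /trans /= coordK.
Qed.

(* Derivatives of functions and components of fields are computed in a chart
   chosen pointwise, without any regularity in [z]; their smoothness comes from
   their independence of the chart. *)
Definition chart_at (z : M) : chart M := projT1 (cid (dom_cover z)).

Lemma dom_chart_at z : dom (chart_at z) z.
Proof. exact: projT2 (cid (dom_cover z)). Qed.

Definition lie_fun X f (z : M) : R := lie_deriv X f z (chart_at z).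

Lemma lie_funE W X f c z : open W -> vector_field W X -> smooth_fun W f ->
  W z -> dom c z -> lie_fun X f z = lie_deriv X f z c.
Proof.
move=> oW vX cf Wz cz; apply: (lie_deriv_chart oW vX cf Wz) => //.
exact: dom_chart_at.
Qed.

Lemma smooth_lie_fun W X f : open W -> vector_field W X -> smooth_fun W f ->
  smooth_fun W (lie_fun X f).
Proof.
move=> oW vX cf c k; have oA := @open_coord_image W c oW.
apply: (@Ck_ext _ _ _ k _ (fun x => 'D_(X (param c x) c)
    (fun x => f (param c x)) x)) => //; last first.
  by apply: Ck_directional (vX.2 c k) (cf c k.+1).
move=> _ [p [Wp cp] <-]; by rewrite (coordK cp) (lie_funE oW vX cf Wp cp).
Qed.

Lemma lie_deriv_commutator W X Y f c z : open W -> vector_field W X ->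
  vector_field W Y -> smooth_fun W f -> W z -> dom c z ->
  lie_deriv X (lie_fun Y f) z c - lie_deriv Y (lie_fun X f) z c =
  lie_deriv (lie_bracket X Y) f z c.
Proof.
move=> oW vX vY cf Wz cz; have oA := @open_coord_image W c oW.
have Az : (coord c @` (W `&` dom c)) (coord c z) by exists z.
(* In the neighbourhood of the point, [lie_fun] is given by the formula in the fixed chart [c], so
   both may be differentiated alike. *)
have E U V : vector_field W U -> vector_field W V ->
    lie_deriv U (lie_fun V f) z c = 'D_(U z c)
      (fun x => 'D_(V (param c x) c) (fun x => f (param c x)) x) (coord c z).
  move=> vU vV; apply: near_eq_derive.
  apply: filterS (near_param oW Wz cz) => x [Wx cx ex].
  by rewrite (lie_funE oW vV cf Wx cx) /lie_deriv ex.
apply: etrans (congr2 (fun a b => a - b) (E X Y vX vY) (E Y X vY vX)) _.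
have := @derive_commutator _ _ _ _ (fun x => f (param c x))
  (fun x => X (param c x) c) (fun x => Y (param c x) c) _ oA Az (cf c 2%N)
  (smooth_field_differentiable vX Wz cz) (smooth_field_differentiable vY Wz cz).
rewrite /lie_deriv /lie_bracket coordK //; apply.
exact: Schwarz oA Az (cf c 2%N).
Qed.

(* Applied to the transition map [trans c c'], the commutator formula gives the
   transformation law of the bracket. *)
Lemma lie_bracket_vector_field W X Y : open W -> vector_field W X ->
  vector_field W Y -> vector_field W (lie_bracket X Y).
Proof.
move=> oW vX vY; split=> [z Wz c c' cz c'z|c k]; last first.
  have oA := @open_coord_image W c oW.
  pose L U V x := 'D_(U (param c x) c) (fun x => V (param c x) c) x : 'rV[R]_m.
  have cL U V : vector_field W U -> vector_field W V ->
      Ck k (coord c @` (W `&` dom c)) (L U V).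
    by move=> vU vV; exact: Ck_directional (vU.2 c k) (vV.2 c k.+1).
  have cN := Ck_scale oA (Ck_cst k _ (-1 : R)) (cL Y X vY vX).
  apply: Ck_ext (Ck_add oA (cL X Y vX vY) cN) => // _ [p [Wp cp] <-].
  by rewrite /lie_bracket /L !fctE !(coordK cp) scaleN1r.
have oWc' : open (W `&` dom c') by exact: openI oW (@open_dom c').
have oA := @open_coord_image _ c oWc'.
set A := coord c @` _ in oA.
have Az : A (coord c z) by exists z.
have cT : Ck 2 A (trans c c').
  apply: Ck_subset (@smooth_transition _ _ M c c' 2%N).
  by move=> _ [p [[_ c'p] cp] <-]; exists p.
have dT := trans_differentiable_at cz c'z.
have TE : trans c c' (coord c z) = coord c' z by rewrite /trans coordK.
(* The derivative in [c'] is pulled back to [c], where the components of [V] in [c'] are the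
   derivative of the transition map along [V]. *)
have E U V : vector_field W U -> vector_field W V ->
    'D_(U z c') (fun x => V (param c' x) c') (coord c' z) =
    'D_(U z c) (fun x => 'D_(V (param c x) c) (trans c c') x) (coord c z).
  move=> vU vV; have dV := smooth_field_differentiable vV Wz c'z.
  have := @derive_comp _ _ _ _ (trans c c') (fun x => V (param c' x) c')
    (coord c z) (U z c) dT.
  rewrite TE -(vU.1 z Wz c c' cz c'z) => /(_ dV) <-.
  apply: near_eq_derive.
  apply: filterS (near_param oWc' (conj Wz c'z) cz) => x [[Wx c'x] cx ex].
  by rewrite /= {1}/trans coordK // (vV.1 _ Wx c c' cx c'x) ex.
apply: etrans (congr2 (fun a b => a - b) (E X Y vX vY) (E Y X vY vX)) _.
have := @derive_commutator _ _ _ A (trans c c')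
  (fun x => X (param c x) c) (fun x => Y (param c x) c) _ oA Az cT
  (smooth_field_differentiable vX Wz cz) (smooth_field_differentiable vY Wz cz).
rewrite /lie_bracket coordK //; apply.
exact: Schwarz_rV oA Az cT.
Qed.

End VectorFieldCalculus.

(** * Connections with a parallel frame *)

Section ParallelFrame.
Variables (R : realType) (m : nat) (M : manifold R m).
Implicit Types (W : set M) (X Y Z : field M) (f : M -> R) (c : chart M).

Variable e : 'I_m -> field M.
Hypothesis e_field : forall i, vector_field setT (e i).
Hypothesis e_free : forall z c, dom c z -> row_free (\matrix_(i < m) e i z c).

Definition frame_mx z c : 'M[R]_m := \matrix_(i < m) e i z c.

Definition frame_comp Z (i : 'I_m) (z : M) : R :=
  (Z z (chart_at z) *m invmx (frame_mx z (chart_at z))) 0 i.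

Lemma frame_mx_unit z c : dom c z -> frame_mx z c \in unitmx.
Proof. by move=> cz; rewrite -row_free_unit e_free. Qed.

(** Linear algebra gives the expansion in the chart [chart_at z]; both sides are tangent vectors, so
    it carries over to every other chart. *)
Lemma frame_decomp W Z : vector_field W Z ->
  field_eq W Z (fun z c => \sum_i frame_comp Z i z *: e i z c).
Proof.
move=> [tZ _] z Wz c cz; pose c0 := chart_at z.
have c0z : dom c0 z := dom_chart_at z.
have Z0 : Z z c0 = \sum_i frame_comp Z i z *: e i z c0.
  rewrite -[LHS](mulmxKV (frame_mx_unit c0z)) mulmx_sum_row.
  by apply: eq_bigr => i _; rewrite rowK.
have te := tangent_at_sum (index_enum 'I_m) (fun i => frame_comp Z i z)
  (fun i => (e_field i).1 z I).
by rewrite (tZ z Wz c0 c c0z cz) Z0 -(te c0 c c0z cz).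
Qed.

(** The coefficients do not depend on the chart: the expansion holds in [c], where the frame matrix
    can be inverted as well. *)
Lemma frame_compE W Z z c i : vector_field W Z -> W z -> dom c z ->
  frame_comp Z i z = (Z z c *m invmx (frame_mx z c)) 0 i.
Proof.
move=> vZ Wz cz.
suff -> : Z z c = (\row_j frame_comp Z j z) *m frame_mx z c.
  by rewrite mulmxK ?mxE // frame_mx_unit.
rewrite (frame_decomp vZ Wz cz) mulmx_sum_row.
by apply: eq_bigr => j _; rewrite mxE rowK.
Qed.

(** In a fixed chart the coefficients are those of [Z] times the inverse of a smooth invertible
    matrix. *)
Lemma smooth_frame_comp W Z i : open W -> vector_field W Z ->
  smooth_fun W (frame_comp Z i).
Proof.
move=> oW vZ c k; have oA := @open_coord_image _ _ _ W c oW.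
pose B x := frame_mx (param c x) c.
have uB x : (coord c @` (W `&` dom c)) x -> B x \in unitmx.
  by move=> [p [_ cp] <-]; rewrite /B coordK // frame_mx_unit.
have cB j l : Ck k (coord c @` (W `&` dom c)) (fun x => B x j l).
  have ce := (vector_field_sub (@subsetT _ W) (e_field j)).2 c k.
  by apply: Ck_ext (Ck_coord l oA ce) => // x _; rewrite mxE.
have cV := Ck_invmx oA uB cB.
apply: Ck_ext (@Ck_bigsum _ _ _ k _ _ (index_enum 'I_m) xpredT
  (fun j x => Z (param c x) c 0 j * invmx (B x) j i) oA _) => //.
  move=> _ [p [Wp cp] <-].
  by rewrite /B (coordK cp) (frame_compE i vZ Wp cp) mxE.
move=> j; apply: Ck_mul => //.
exact: Ck_coord oA (vZ.2 c k).
Qed.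

Variable D : field M -> field M -> field M.
Hypothesis D_connection : linear_connection D.
Hypothesis e_parallel : forall i W X, open W -> vector_field W X ->
  field_eq W (D X (e i)) (fun _ _ => 0).

Let e_fieldW W i : vector_field W (e i).
Proof. exact: vector_field_sub (@subsetT _ W) (e_field i). Qed.

Lemma conn_frame_sum W X (f : 'I_m -> M -> R) : open W -> vector_field W X ->
  (forall i, smooth_fun W (f i)) ->
  field_eq W (D X (fun z c => \sum_i f i z *: e i z c))
    (fun z c => \sum_i lie_deriv X (f i) z c *: e i z c).
Proof.
move=> oW vX cf z Wz c cz; elim: (index_enum 'I_m) => [|i r IH].
  have v0 : vector_field W (fun (_ : M) (_ : chart M) => 0).
    have := @vector_field_sum _ _ _ W _ [::] f e oW cf (e_fieldW W).
    by apply: vector_field_eq => // p _ c' _; rewrite big_nil.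
  rewrite big_nil; under eq2_fun do rewrite big_nil.
  (* Additivity at 0 + 0 = 0 shows that the derivative of the zero field vanishes. *)
  have := conn_addr D_connection oW vX v0 v0 Wz cz.
  under eq2_fun do rewrite addr0.
  by move/esym/eqP; rewrite -subr_eq0 addrK => /eqP.
have vi : vector_field W (fun z c => f i z *: e i z c).
  have := @vector_field_sum _ _ _ W _ [:: i] f e oW cf (e_fieldW W).
  by apply: vector_field_eq => // p _ c' _; rewrite big_seq1.
have vr := vector_field_sum r oW cf (e_fieldW W).
under eq2_fun do rewrite big_cons.
rewrite (conn_addr D_connection oW vX vi vr Wz cz) IH big_cons; congr (_ + _).
rewrite (conn_leibniz D_connection oW (cf i) vX (e_fieldW W i) Wz cz).
by rewrite (@e_parallel i W X oW vX z Wz c cz) scaler0 addr0.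
Qed.

Lemma conn_frame W X Z : open W -> vector_field W X -> vector_field W Z ->
  field_eq W (D X Z)
    (fun z c => \sum_i lie_deriv X (frame_comp Z i) z c *: e i z c).
Proof.
move=> oW vX vZ z Wz c cz.
(* The expansion agrees with [Z] only on [W], so locality is what permits the substitution. *)
rewrite (conn_local D_connection oW vX vZ (fun _ _ _ _ => erefl)
  (frame_decomp vZ) Wz cz).
by rewrite (conn_frame_sum oW vX _ Wz cz) // => i; exact: smooth_frame_comp.
Qed.

Lemma conn_conn_frame W X Y Z : open W -> vector_field W X ->
  vector_field W Y -> vector_field W Z ->
  field_eq W (D X (D Y Z))
    (fun z c => \sum_i lie_deriv X (lie_fun Y (frame_comp Z i)) z c *: e i z c).
Proof.
move=> oW vX vY vZ z Wz c cz.
have cZ i := smooth_frame_comp i oW vZ.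
(* The coefficients are rewritten by [lie_fun], which takes no chart and is smooth on [W], so that
   [conn_frame_sum] applies a second time. *)
have DE : field_eq W (D Y Z)
    (fun z c => \sum_i lie_fun Y (frame_comp Z i) z *: e i z c).
  move=> p Wp c' cp; rewrite (conn_frame oW vY vZ Wp cp).
  by apply: eq_bigr => i _; rewrite (lie_funE oW vY (cZ i) Wp cp).
have vDZ := conn_field D_connection oW vY vZ.
rewrite (conn_local D_connection oW vX vDZ (fun _ _ _ _ => erefl) DE Wz cz).
by rewrite (conn_frame_sum oW vX _ Wz cz) // => i; exact: smooth_lie_fun.
Qed.

Lemma curvature_parallel_frame W X Y Z : open W -> vector_field W X ->
  vector_field W Y -> vector_field W Z ->
  field_eq W (curvature D X Y Z) (fun _ _ => 0).
Proof.
move=> oW vX vY vZ z Wz c cz; rewrite /curvature.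
rewrite (conn_conn_frame oW vX vY vZ Wz cz) (conn_conn_frame oW vY vX vZ Wz cz).
rewrite (conn_frame oW (lie_bracket_vector_field oW vX vY) vZ Wz cz).
rewrite -!sumrB big1 // => i _; rewrite -!scalerBl.
rewrite (lie_deriv_commutator oW vX vY (smooth_frame_comp i oW vZ) Wz cz).
by rewrite subrr scale0r.
Qed.

End ParallelFrame.

(** * The frame of an EAP-space *)

Section AdaptedFrame.
Variables (R : realType) (n : nat) (M : manifold R n).
Local Notation TM := (tangent_bundle M).
Variable N : chart M -> TM -> 'M[R]_n.
Hypothesis N_connection : nonlinear_connection N.
Implicit Types (c : chart TM) (z : TM) (X : field TM).

Lemma dy_vector_field c a : vector_field (dom c) (dy c a).
Proof. exact: coord_vector_field. Qed.

Lemma delta_vector_field c mu : vector_field (dom c) (delta N c mu).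
Proof.
apply: vector_fieldB; first exact: open_dom.
  exact: coord_vector_field.
apply: vector_field_sum; first exact: open_dom.
  by move=> a; exact: N_connection.1.
exact: dy_vector_field.
Qed.

Lemma dyE c a z : dom c z -> dy c a z c = row_mx 0 (delta_mx 0 a).
Proof. exact: coord_fieldE. Qed.

Lemma lsubmx_delta c mu z : dom c z ->
  lsubmx (delta N c mu z c) = delta_mx 0 mu.
Proof.
move=> cz; rewrite /delta linearB /= linear_sum /= big1 ?subr0.
  by rewrite /dx coord_fieldE // row_mxKl.
by move=> a _; rewrite linearZ /= dyE // row_mxKl scaler0.
Qed.

Lemma lsubmx_hpart c X z : dom c z -> lsubmx (hpart N X z c) = lsubmx (X z c).
Proof.
move=> cz; rewrite linear_sum [RHS]row_sum_delta.
by apply: eq_bigr => mu _; rewrite linearZ /= lsubmx_delta.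
Qed.

Lemma lsubmx_vpart c X z : dom c z -> lsubmx (vpart N X z c) = 0.
Proof.
move=> cz; rewrite linear_sum big1 // => a _.
by rewrite linearZ /= dyE // row_mxKl scaler0.
Qed.

Lemma hpartE c X z :
  hpart N X z c = lsubmx (X z c) *m \matrix_(mu < n) delta N c mu z c.
Proof. by rewrite mulmx_sum_row; apply: eq_bigr => mu _; rewrite rowK. Qed.

(** The block [lsubmx] is the differential of the projection of TM onto M in induced coordinates.
    The projection commutes with the transition maps, and the chain rule is applied to both
    composites. *)
Lemma lsubmx_tangent c c' z (v : chart TM -> 'rV[R]_(n + n)) :
  tangent_at z v -> dom c z -> dom c' z ->
  lsubmx (v c') =
  'D_(lsubmx (v c)) (@trans _ _ M c c') (@coord _ _ M c (base z)).
Proof.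
move=> tv cz c'z; pose l : {linear 'rV[R]_(n + n) -> 'rV[R]_n} := lsubmx.
have cl : continuous l by exact: continuous_lsubmx.
have dl x : differentiable l x by exact: linear_differentiable.
have dTM := @trans_differentiable_at _ _ TM c c' z cz c'z.
have dT : differentiable (@trans _ _ M c c') (l (@coord _ _ TM c z)).
  by rewrite /l /= /tcoord row_mxKl; apply: trans_differentiable_at.
have lE : l (@coord _ _ TM c z) = @coord _ _ M c (base z).
  by rewrite /l /= /tcoord row_mxKl.
have E1 := @derive_comp _ _ _ _ (@trans _ _ TM c c') l _ (v c) dTM (dl _).
have E2 := @derive_comp _ _ _ _ l (@trans _ _ M c c') _ (v c) (dl _) dT.
rewrite (derive_lin _ _ cl) in E1; rewrite (derive_lin _ _ cl) lE in E2.
rewrite (tv c c' cz c'z); apply: etrans (esym E1) (etrans _ E2).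
apply: near_eq_derive.
apply: filterS (near_param (@open_dom _ _ TM c') c'z cz) => x _.
by rewrite /trans /= /tcoord row_mxKl.
Qed.

(** The horizontal part is the same from either chart: its components and the fields [delta]
    transform by the Jacobian of the base transition in opposite ways. *)
Lemma hpart_chart c c' X z : tangent_at z (X z) -> dom c z -> dom c' z ->
  \sum_alpha hcomp c X z alpha *: delta N c alpha z c' = hpart N X z c'.
Proof.
move=> tX cz c'z.
have dT := @trans_differentiable_at _ _ M c c' (base z) cz c'z.
rewrite /hpart /hcomp (lsubmx_tangent tX cz c'z) (derive_rowE _ dT).
under [RHS]eq_bigr do rewrite summxE scaler_suml.
rewrite exchange_big; apply: eq_bigr => mu _ /=.
rewrite (N_connection.2 c c' mu) // scaler_sumr.
by apply: eq_bigr => nu _; rewrite scalerA; congr (_ *: _); rewrite [RHS]mxE.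
Qed.

Lemma hpart_vector_field X : vector_field setT X ->
  vector_field setT (hpart N X).
Proof.
move=> [tX cX]; split=> [z _ c c' cz c'z|c k].
  (* [hpart] uses a different frame in each chart; now a single combination of the frame of [c] is
     seen in both charts. *)
  rewrite -(hpart_chart (tX z I) cz c'z).
  apply: (tangent_at_sum (index_enum 'I_n) (hcomp c X z)
    (v := fun alpha => delta N c alpha z)) => // alpha.
  exact: (delta_vector_field c alpha).1.
have oA := open_coord_image (c := c) (@openT TM).
apply: Ck_bigsum => // alpha; apply: Ck_scale => //.
  apply: Ck_ext (Ck_coord (lshift n alpha) oA (cX c k)) => // x _.
  by rewrite /hcomp mxE.
by have := (delta_vector_field c alpha).2 c k; rewrite setIid setTI.
Qed.

(** By [adapted_frameE] this is [X] minus its horizontal part, so no transformation law for vertical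
    components has to be established. *)
Lemma vpart_vector_field X : vector_field setT X ->
  vector_field setT (vpart N X).
Proof.
move=> vX.
have := vector_fieldB openT vX (hpart_vector_field vX).
apply: vector_field_eq; first exact: openT.
by move=> z _ c cz; rewrite [X z c](adapted_frameE N) // addrAC subrr add0r.
Qed.

Variable lambda : 'I_n -> field TM.
Hypothesis EAP_lambda : EAP_space N lambda.

Definition lambda_frame (i : 'I_(n + n)) : field TM :=
  match fintype.split i with
  | inl j => hpart N (lambda j)
  | inr j => vpart N (lambda j)
  end.

Lemma lambda_frame_field i : vector_field setT (lambda_frame i).
Proof.
have [vl _ _] := EAP_lambda; rewrite /lambda_frame.
by case: (fintype.split i) => j;
  [exact: hpart_vector_field|exact: vpart_vector_field].
Qed.

(** Vertical rows have zero x-block and horizontal rows are determined by theirs. A vanishing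
    combination therefore has zero horizontal part, then zero vertical part, and each family is
    free. *)
Lemma lambda_frame_free z c : dom c z ->
  row_free (\matrix_(i < n + n) lambda_frame i z c).
Proof.
move=> cz; have [_ /(_ z c cz) freeH /(_ z c cz) freeV] := EAP_lambda.
set H := \matrix_(i < n) hpart N _ z c in freeH.
set V := \matrix_(i < n) vpart N _ z c in freeV.
have -> : \matrix_(i < n + n) lambda_frame i z c = col_mx H V.
  apply/matrixP => i j; rewrite !mxE /lambda_frame.
  by case: (fintype.split i) => k; rewrite !mxE.
have row_lsubmx (B : 'M[R]_(n, n + n)) i : row i (lsubmx B) = lsubmx (row i B).
  by apply/rowP => j; rewrite !mxE.
have HE : H = lsubmx H *m \matrix_(mu < n) delta N c mu z c.
  apply/row_matrixP => i; rewrite row_mul rowK hpartE; congr (_ *m _).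
  by rewrite row_lsubmx rowK lsubmx_hpart.
have V0 : lsubmx V = 0.
  by apply/row_matrixP => i; rewrite row_lsubmx rowK lsubmx_vpart // row0.
apply: inj_row_free => v.
rewrite -[v]hsubmxK mul_row_col => vHV.
have lH0 : lsubmx v *m lsubmx H = 0.
  have := congr1 lsubmx vHV.
  by rewrite linearD /= -!mulmx_lsub V0 mulmx0 addr0 linear0.
have H0 : lsubmx v *m H = 0 by rewrite HE mulmxA lH0 mul0mx.
rewrite H0 add0r in vHV.
move/eqP: H0; rewrite mulmx_free_eq0 // => /eqP ->.
by move/eqP: vHV; rewrite mulmx_free_eq0 // => /eqP ->; rewrite row_mx0.
Qed.

End AdaptedFrame.

Theorem theorem3p2 (R : realType) (n : nat) (M : manifold R n)
    (hausdorff_M : hausdorff_space M) (paracompact_M : paracompact M)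
    (N : chart M -> tangent_bundle M -> 'M[R]_n)
    (N_connection : nonlinear_connection N)
    (lambda : 'I_n -> field (tangent_bundle M))
    (EAP_lambda : EAP_space N lambda)
    (D : field (tangent_bundle M) -> field (tangent_bundle M) ->
         field (tangent_bundle M))
    (canonical_D : canonical_d_connection N lambda D) :
  (forall (W : set (tangent_bundle M)) (X Y Z : field (tangent_bundle M)),
     open W -> vector_field W X -> vector_field W Y -> vector_field W Z ->
     field_eq W (curvature D X Y Z) (fun _ _ => 0)) /\
  (forall (c : chart (tangent_bundle M)) (z : tangent_bundle M), dom c z ->
     [/\ forall alpha beta mu nu : 'I_n, Rh N D c z alpha beta mu nu = 0,
         forall a b mu nu : 'I_n, Rv N D c z a b mu nu = 0 &
         forall alpha beta nu e : 'I_n, Ph N D c z alpha beta nu e = 0] /\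
     [/\ forall a b nu e : 'I_n, Pv N D c z a b nu e = 0,
         forall alpha beta b e : 'I_n, Sh N D c z alpha beta b e = 0 &
         forall a b d e : 'I_n, Sv N D c z a b d e = 0]).
Proof.
have [[D_linear _ _] parallel_h parallel_v] := canonical_D.
have flat W X Y Z : open W -> vector_field W X -> vector_field W Y ->
    vector_field W Z -> field_eq W (curvature D X Y Z) (fun _ _ => 0).
  apply: (curvature_parallel_frame (lambda_frame_field N_connection EAP_lambda)
    (lambda_frame_free EAP_lambda) D_linear).
  move=> i V U oV vU; rewrite /lambda_frame.
  by case: (fintype.split i) => j; [exact: parallel_h|exact: parallel_v].
split=> [W X Y Z|c z cz]; first exact: flat.
(* The adapted frame of [c] consists of vector fields on [dom c] only, so flatness is used over this
   open set. *)
have hcomp0 X Y Z alpha : vector_field (dom c) X -> vector_field (dom c) Y ->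
    vector_field (dom c) Z -> hcomp c (curvature D X Y Z) z alpha = 0.
  move=> vX vY vZ.
  by rewrite /hcomp (flat _ _ _ _ (@open_dom _ _ _ c) vX vY vZ z cz c cz) !mxE.
have vcomp0 X Y Z a : vector_field (dom c) X -> vector_field (dom c) Y ->
    vector_field (dom c) Z -> vcomp N c (curvature D X Y Z) z a = 0.
  move=> vX vY vZ.
  rewrite /vcomp (flat _ _ _ _ (@open_dom _ _ _ c) vX vY vZ z cz c cz).
  by rewrite big1 ?addr0 ?mxE // => mu _; rewrite mxE mxE mulr0.
by split; split=> *; (apply: hcomp0 || apply: vcomp0);
  (exact: delta_vector_field || exact: dy_vector_field).
Qed.
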